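(* Let $H:\mathbb{A}\to\mathbb{A}$ be an endofunctor carrying a monad structure $\underline H=(H,m_H,e_H)$ and a comonad structure $\overline H=(H,\delta_H,\varepsilon_H)$, and suppose $H$ has a right adjoint $R$. Let $\underline R=(R,m_R,e_R)$ be the monad and $\overline R=(R,\delta_R,\varepsilon_R)$ the comonad induced on $R$ by taking mates: $m_R,e_R,\delta_R,\varepsilon_R$ are the mates of $\delta_H,\varepsilon_H,m_H,e_H$, respectively. Then, for natural transformations $\lambda_H,\lambda'_H:HH\to HH$ with mates $\lambda_R,\lambda'_R:RR\to RR$: (1) $(\underline H,\overline H)$ is a bimonad with entwining $\lambda_H:\underline H\,\overline H\to\overline H\,\underline H$ if and only if $(\underline R,\overline R)$ is a bimonad with entwining $\lambda_R:\overline R\,\underline R\to\underline R\,\overline R$. (2) $(\underline H,\overline H)$ is a bimonad with entwining $\lambda'_H:\overline H\,\underline H\to\underline H\,\overline H$ if and only if $(\underline R,\overline R)$ is a bimonad with entwining $\lambda'_R:\underline R\,\overline R\to\overline R\,\underline R$. (3) If $(\underline H,\overline H,\lambda_H)$ is a bimonad with an antipode, then $(\underline R,\overline R,\lambda_R)$ is a bimonad with an antipode (a Hopf monad).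
   Context: Composition of functors is written by juxtaposition, $\cdot$ is vertical composition, whiskering is written $B\alpha$, $\alpha B$. Mates: if $H\dashv R$, then $H^n\dashv R^n$ for all $n\ge 0$. With $\eta^{(n)}:1\to R^nH^n$ and $\sigma^{(n)}:H^nR^n\to1$ the unit and counit, the mate of $\alpha:H^p\to H^q$ is the composite $R^q\xrightarrow{\eta^{(p)}R^q}R^pH^pR^q\xrightarrow{R^p\alpha R^q}R^pH^qR^q\xrightarrow{R^p\sigma^{(q)}}R^p$. The mate of a monad (resp. comonad) structure on $H$ is a comonad (resp. monad) structure on $R$. Let $B$ be an endofunctor with a monad structure $\underline B=(B,m,e)$ and a comonad structure $\overline B=(B,\delta,\varepsilon)$, and let $\lambda:BB\to BB$ be a natural transformation. Entwining $\lambda:\underline B\,\overline B\to\overline B\,\underline B$ (mixed distributive law from the monad to the comonad): $\lambda\cdot eB=Be$, $\varepsilon B\cdot\lambda=B\varepsilon$, $\delta B\cdot\lambda=B\lambda\cdot\lambda B\cdot B\delta$, $\lambda\cdot mB=Bm\cdot\lambda B\cdot B\lambda$. Entwining $\lambda:\overline B\,\underline B\to\underline B\,\overline B$ (mixed distributive law from the comonad to the monad): $\lambda\cdot Be=eB$, $B\varepsilon\cdot\lambda=\varepsilon B$, $B\delta\cdot\lambda=\lambda B\cdot B\lambda\cdot\delta B$, $\lambda\cdot Bm=mB\cdot B\lambda\cdot\lambda B$. $(\underline B,\overline B)$ is a bimonad with entwining $\lambda$ if $\varepsilon\cdot e=1$, $\varepsilon\cdot m=\varepsilon\cdot B\varepsilon$,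 $\delta\cdot e=eB\cdot e$, $\lambda$ is an entwining of the indicated kind, and - $\delta\cdot m=Bm\cdot\lambda B\cdot B\delta$ when $\lambda:\underline B\,\overline B\to\overline B\,\underline B$; - $\delta\cdot m=mB\cdot B\lambda\cdot\delta B$ when $\lambda:\overline B\,\underline B\to\underline B\,\overline B$. An antipode is a natural transformation $S:B\to B$ with $m\cdot SB\cdot\delta=e\cdot\varepsilon=m\cdot BS\cdot\delta$; a Hopf monad is a bimonad with an antipode. *)

(* Defs.v *)
From Stdlib Require Import FunctionalExtensionality ProofIrrelevance.

Set Implicit Arguments.
Unset Strict Implicit.
Unset Printing Implicit Defensive.
Set Primitive Projections.

Declare Scope cat_scope.
Delimit Scope cat_scope with cat.
Local Open Scope cat_scope.

Record Category := {
  Ob :> Type;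
  Hom : Ob -> Ob -> Type;
  idm : forall x, Hom x x;
  compm : forall x y z, Hom y z -> Hom x y -> Hom x z;
  compm_idl : forall x y (f : Hom x y), compm (idm y) f = f;
  compm_idr : forall x y (f : Hom x y), compm f (idm x) = f;
  compm_assoc : forall w x y z (h : Hom y z) (g : Hom x y) (f : Hom w x),
    compm h (compm g f) = compm (compm h g) f }.

Arguments Hom {c} x y.
Arguments idm {c} x.
Arguments compm {c x y z} g f.
Notation "g ∘ f" := (compm g f) (at level 40, left associativity) : cat_scope.

(* Functors are split into data and laws, and natural transformations only
   refer to the data.  Thanks to eta for primitive records, composition of
   functor data is associative and unital up to conversion, so that m · (m ▷ B)
   and m · (B ◁ m) can be compared without inserting associators. *)
Record FunctorData (C D : Category) := {
  fobj :> C -> D;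
  fmap : forall x y : C, Hom x y -> Hom (fobj x) (fobj y) }.

Arguments fmap {C D} F {x y} f : rename.

Record Functor (C D : Category) := {
  fdata :> FunctorData C D;
  fmap_id : forall x : C, fmap fdata (idm x) = idm (fdata x);
  fmap_comp : forall (x y z : C) (g : Hom y z) (f : Hom x y),
    fmap fdata (g ∘ f) = fmap fdata g ∘ fmap fdata f }.

Definition IdD (C : Category) : FunctorData C C :=
  {| fobj := fun x => x; fmap := fun _ _ f => f |}.

Definition compD (C D E : Category) (G : FunctorData D E) (F : FunctorData C D)
    : FunctorData C E :=
  {| fobj := fun x => G (F x); fmap := fun _ _ f => fmap G (fmap F f) |}.

Arguments IdD {C}.
Notation "G ⊚ F" := (compD G F) (at level 35, right associativity) : cat_scope.

Definition IdF (C : Category) : Functor C C :=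
  {| fdata := IdD; fmap_id := fun _ => eq_refl;
     fmap_comp := fun _ _ _ _ _ => eq_refl |}.

Definition compF (C D E : Category) (G : Functor D E) (F : Functor C D)
    : Functor C E.
Proof.
refine {| fdata := G ⊚ F |}.
- abstract (intros; simpl; now rewrite (fmap_id F), (fmap_id G)).
- abstract (intros; simpl; now rewrite (fmap_comp F), (fmap_comp G)).
Defined.

Arguments IdF {C}.

Record NatTrans (C D : Category) (F G : FunctorData C D) := {
  ntc :> forall x : C, Hom (F x) (G x);
  nt_nat : forall (x y : C) (f : Hom x y), ntc y ∘ fmap F f = fmap G f ∘ ntc x }.

Notation "F ==> G" := (NatTrans F G) (at level 70, no associativity) : cat_scope.

Lemma nat_trans_ext (C D : Category) (F G : FunctorData C D) (a b : F ==> G) :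
  (forall x, a x = b x) -> a = b.
Proof.
destruct a as [a Ha], b as [b Hb]; simpl; intros H.
assert (E : a = b) by (apply functional_extensionality_dep; exact H).
subst b; f_equal; apply proof_irrelevance.
Qed.

Definition idN (C D : Category) (F : Functor C D) : F ==> F.
Proof.
refine {| ntc := fun x => idm (F x) |}.
abstract (intros; now rewrite compm_idl, compm_idr).
Defined.

Definition vcomp (C D : Category) (F G K : FunctorData C D)
    (b : G ==> K) (a : F ==> G) : F ==> K.
Proof.
refine {| ntc := fun x => b x ∘ a x |}.
abstract (intros; now rewrite <- compm_assoc, nt_nat, compm_assoc, nt_nat,
  compm_assoc).
Defined.

Definition whiskerL (C D E : Category) (B : Functor D E) (F G : FunctorData C D)
    (a : F ==> G) : B ⊚ F ==> B ⊚ G.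
Proof.
refine {| ntc := fun x => fmap B (a x) : Hom ((B ⊚ F) x) ((B ⊚ G) x) |}.
abstract (intros; simpl; now rewrite <- !fmap_comp, nt_nat).
Defined.

Definition whiskerR (C D E : Category) (F G : FunctorData D E) (a : F ==> G)
    (B : FunctorData C D) : F ⊚ B ==> G ⊚ B.
Proof.
refine {| ntc := fun x => a (B x) : Hom ((F ⊚ B) x) ((G ⊚ B) x) |}.
abstract (intros; simpl; now rewrite nt_nat).
Defined.

Notation "b · a" := (vcomp b a) (at level 45, left associativity) : cat_scope.
Notation "B ◁ a" := (whiskerL B a) (at level 38, right associativity) : cat_scope.
Notation "a ▷ B" := (whiskerR a B) (at level 37, left associativity) : cat_scope.

Record Adjunction (C D : Category) (F : Functor C D) (G : Functor D C) := {
  adj_unit : IdD ==> G ⊚ F;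
  adj_counit : F ⊚ G ==> IdD;
  triangleL : (adj_counit ▷ F) · (F ◁ adj_unit) = idN F;
  triangleR : (G ◁ adj_counit) · (adj_unit ▷ G) = idN G }.

Definition adj_id (C : Category) : Adjunction (@IdF C) (@IdF C).
Proof.
refine (@Build_Adjunction C C IdF IdF (idN IdF) (idN IdF) _ _);
  abstract (apply nat_trans_ext; intros x; simpl; apply compm_idl).
Defined.

Arguments adj_id {C}.

Definition adj_comp (C D E : Category)
    (F : Functor C D) (G : Functor D C) (F' : Functor D E) (G' : Functor E D)
    (a' : Adjunction F' G') (a : Adjunction F G)
    : Adjunction (compF F' F) (compF G G').
Proof.
refine (@Build_Adjunction C E (compF F' F) (compF G G')
  ((G ◁ adj_unit a' ▷ F) · adj_unit a)
  (adj_counit a' · (F' ◁ adj_counit a ▷ G')) _ _).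
- abstract (apply nat_trans_ext; intros x;
    pose proof (f_equal (fun t => ntc t x) (triangleL a)) as T;
    pose proof (f_equal (fun t => ntc t (F x)) (triangleL a')) as T';
    pose proof (nt_nat (adj_counit a) (adj_unit a' (F x))) as N;
    simpl in *;
    rewrite <- compm_assoc, <- (fmap_comp F'), (fmap_comp F), compm_assoc, N,
      <- compm_assoc, T, compm_idr; exact T').
- abstract (apply nat_trans_ext; intros x;
    pose proof (f_equal (fun t => ntc t (G' x)) (triangleR a)) as T;
    pose proof (f_equal (fun t => ntc t x) (triangleR a')) as T';
    pose proof (nt_nat (adj_unit a') (adj_counit a (G' x))) as N;
    simpl in *;
    rewrite compm_assoc, <- (fmap_comp G), (fmap_comp G'), <- compm_assoc, <- N,
      compm_assoc, T', compm_idl; exact T).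
Defined.

(* For F := H^p and F' := H^q this is the mate R^q ==> R^p; for exponents up to
   two the adjunctions H^n ⊣ R^n are adj_id, adj and adj_comp adj adj. *)
Definition mate (C D : Category) (F F' : Functor C D) (G G' : Functor D C)
    (a : Adjunction F G) (a' : Adjunction F' G') (alpha : F ==> F') : G' ==> G :=
  (G ◁ adj_counit a') · (G ◁ alpha ▷ G') · (adj_unit a ▷ G').

Section Structures.
Context (C : Category) (B : Functor C C).
Implicit Types (m : B ⊚ B ==> B) (e : IdD ==> B)
  (delta : B ==> B ⊚ B) (epsilon : B ==> IdD) (lambda : B ⊚ B ==> B ⊚ B)
  (S : B ==> B).

Record IsMonad m e : Prop := {
  monad_assoc : m · (m ▷ B) = m · (B ◁ m);
  monad_unitl : m · (e ▷ B) = idN B;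
  monad_unitr : m · (B ◁ e) = idN B }.

Record IsComonad delta epsilon : Prop := {
  comonad_coassoc : (delta ▷ B) · delta = (B ◁ delta) · delta;
  comonad_counitl : (epsilon ▷ B) · delta = idN B;
  comonad_counitr : (B ◁ epsilon) · delta = idN B }.

(* mixed distributive law λ : (B,m,e)(B,δ,ε) -> (B,δ,ε)(B,m,e), from the monad
   to the comonad *)
Record IsEntwiningMC m e delta epsilon lambda : Prop := {
  entwMC_unit : lambda · (e ▷ B) = B ◁ e;
  entwMC_counit : (epsilon ▷ B) · lambda = B ◁ epsilon;
  entwMC_comult :
    (delta ▷ B) · lambda = (B ◁ lambda) · (lambda ▷ B) · (B ◁ delta);
  entwMC_mult : lambda · (m ▷ B) = (B ◁ m) · (lambda ▷ B) · (B ◁ lambda) }.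

(* mixed distributive law λ : (B,δ,ε)(B,m,e) -> (B,m,e)(B,δ,ε), from the comonad
   to the monad *)
Record IsEntwiningCM m e delta epsilon lambda : Prop := {
  entwCM_unit : lambda · (B ◁ e) = e ▷ B;
  entwCM_counit : (B ◁ epsilon) · lambda = epsilon ▷ B;
  entwCM_comult :
    (B ◁ delta) · lambda = (lambda ▷ B) · (B ◁ lambda) · (delta ▷ B);
  entwCM_mult : lambda · (B ◁ m) = (m ▷ B) · (B ◁ lambda) · (lambda ▷ B) }.

Record IsPreBimonad m e delta epsilon : Prop := {
  bimonad_monad : IsMonad m e;
  bimonad_comonad : IsComonad delta epsilon;
  bimonad_counit_unit : epsilon · e = idN IdF;
  bimonad_counit_mult : epsilon · m = epsilon · (B ◁ epsilon);
  bimonad_comult_unit : delta · e = (e ▷ B) · e }.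

Record IsBimonadMC m e delta epsilon lambda : Prop := {
  bimonadMC_pre : IsPreBimonad m e delta epsilon;
  bimonadMC_entwining : IsEntwiningMC m e delta epsilon lambda;
  bimonadMC_comult_mult :
    delta · m = (B ◁ m) · (lambda ▷ B) · (B ◁ delta) }.

Record IsBimonadCM m e delta epsilon lambda : Prop := {
  bimonadCM_pre : IsPreBimonad m e delta epsilon;
  bimonadCM_entwining : IsEntwiningCM m e delta epsilon lambda;
  bimonadCM_comult_mult :
    delta · m = (m ▷ B) · (B ◁ lambda) · (delta ▷ B) }.

Definition IsAntipode m e delta epsilon S : Prop :=
  m · (S ▷ B) · delta = e · epsilon /\ m · (B ◁ S) · delta = e · epsilon.

Definition HasAntipode m e delta epsilon : Prop :=
  exists S, IsAntipode m e delta epsilon S.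

End Structures.

(* Main.v *)
Require Import Defs.
Local Open Scope cat_scope.

Set Implicit Arguments.
Unset Strict Implicit.
Unset Printing Implicit Defensive.

(** Taking mates is a bijection between transformations H^p ==> H^q and
    transformations R^q ==> R^p.  It reverses vertical composition, and it turns
    whiskering by H on one side into whiskering by R on the other side.  Hence an
    equation between composites of whiskered transformations holds for H exactly
    when the mirror-image equation, with the order of composition and the sides
    of the whiskerings both reversed, holds for R.  This reversal exchanges the
    axioms of a monad with those of a comonad, and those of a bimonad with an
    entwining from the monad to the comonad with those of a bimonad with an
    entwining in the other direction.  The antipode equations are exchanged
    with each other, so the mate of an antipode is an antipode.

    The mate of [α] is handled through its characterisation as the unique [β]
    with [Gα · η = βF' · η'] (see [Conjugate], [conjugate_mate],
    [conjugate_eq_iff]).  In this form compatibility with composition and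
    whiskering ([conjugate_vcomp], [conjugate_whiskerL], [conjugate_whiskerR]) is
    a short computation with naturality in which no counit occurs. *)

(** * Conjugate transformations *)

(** The condition mentions only the units and the functor data.  The adjunctions
    obtained for the two bracketings of H³ are different terms, over functors
    with different proofs of functoriality, but their units can be compared;
    this is why adjunctions are not arguments here. *)
Definition Conjugate (C D : Category) (F F' : FunctorData C D)
    (G G' : FunctorData D C) (u : IdD ==> G ⊚ F) (u' : IdD ==> G' ⊚ F')
    (alpha : F ==> F') (beta : G' ==> G) : Prop :=
  forall x, fmap G (alpha x) ∘ u x = beta (F' x) ∘ u' x.

Section Correspondence.
Context (C D : Category) (F F' : Functor C D) (G G' : Functor D C).
Context (a : Adjunction F G) (a' : Adjunction F' G').

Lemma triangleL_at x : adj_counit a (F x) ∘ fmap F (adj_unit a x) = idm (F x).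
Proof. exact (f_equal (fun t => ntc t x) (triangleL a)). Qed.

Lemma triangleR_at y :
  fmap G' (adj_counit a' y) ∘ adj_unit a' (G' y) = idm (G' y).
Proof. exact (f_equal (fun t => ntc t y) (triangleR a')). Qed.

Lemma conjugate_mate (alpha : F ==> F') :
  Conjugate (adj_unit a) (adj_unit a') alpha (mate a a' alpha).
Proof.
intros x.
pose proof (nt_nat (adj_unit a) (adj_unit a' x)) as N; simpl in N.
pose proof (nt_nat alpha (adj_unit a' x)) as N'; simpl in N'.
pose proof (f_equal (fun t => ntc t x) (triangleL a')) as T; simpl in T.
simpl.
rewrite <- compm_assoc, N, compm_assoc, <- !(fmap_comp G), <- compm_assoc, N'.
now rewrite compm_assoc, T, compm_idl.
Qed.

(** The left-hand side of [Conjugate] is the transpose of [alpha x] across [a],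
    and transposition is injective. *)
Lemma conjugate_left_unique (alpha1 alpha2 : F ==> F') (beta : G' ==> G) :
  Conjugate (adj_unit a) (adj_unit a') alpha1 beta ->
  Conjugate (adj_unit a) (adj_unit a') alpha2 beta -> alpha1 = alpha2.
Proof.
intros H1 H2; apply nat_trans_ext; intros x.
assert (transpose : forall alpha : F ==> F', alpha x =
  adj_counit a (F' x) ∘ fmap F (fmap G (alpha x) ∘ adj_unit a x)).
{ intros alpha.
  pose proof (nt_nat (adj_counit a) (alpha x)) as N; simpl in N.
  pose proof (triangleL_at x) as T; simpl in *.
  now rewrite (fmap_comp F), compm_assoc, N, <- compm_assoc, T, compm_idr. }
now rewrite (transpose alpha1), (transpose alpha2), H1, H2.
Qed.

(** By the triangle identity for [a'] and naturality, [beta y] is recovered from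
    the component of [βF' · η'] at [G' y]. *)
Lemma conjugate_right_unique (alpha : F ==> F') (beta1 beta2 : G' ==> G) :
  Conjugate (adj_unit a) (adj_unit a') alpha beta1 ->
  Conjugate (adj_unit a) (adj_unit a') alpha beta2 -> beta1 = beta2.
Proof.
intros H1 H2; apply nat_trans_ext; intros y.
assert (recover : forall beta : G' ==> G, beta y =
  fmap G (adj_counit a' y) ∘ (beta (F' (G' y)) ∘ adj_unit a' (G' y))).
{ intros beta.
  pose proof (nt_nat beta (adj_counit a' y)) as N; simpl in N.
  pose proof (triangleR_at y) as T; simpl in *.
  now rewrite compm_assoc, <- N, <- compm_assoc, T, compm_idr. }
now rewrite (recover beta1), (recover beta2), <- H1, <- H2.
Qed.

Lemma conjugate_eq_iff (alpha1 alpha2 : F ==> F') (beta1 beta2 : G' ==> G) :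
  Conjugate (adj_unit a) (adj_unit a') alpha1 beta1 ->
  Conjugate (adj_unit a) (adj_unit a') alpha2 beta2 ->
  (alpha1 = alpha2 <-> beta1 = beta2).
Proof.
intros H1 H2; split; intros E; subst.
- now apply (conjugate_right_unique H1).
- now apply (conjugate_left_unique H1).
Qed.

Lemma conjugate_id : Conjugate (adj_unit a) (adj_unit a) (idN F) (idN G).
Proof. intros x; simpl; now rewrite (fmap_id G), !compm_idl. Qed.

End Correspondence.

Section Calculus.
Context (C D E : Category).

Lemma conjugate_vcomp (F F' F'' : FunctorData C D) (G : Functor D C)
    (G' G'' : FunctorData D C) (u : IdD ==> G ⊚ F) (u' : IdD ==> G' ⊚ F')
    (u'' : IdD ==> G'' ⊚ F'') (alpha : F ==> F') (beta : G' ==> G)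
    (alpha' : F' ==> F'') (beta' : G'' ==> G') :
  Conjugate u u' alpha beta -> Conjugate u' u'' alpha' beta' ->
  Conjugate u u'' (alpha' · alpha) (beta · beta').
Proof.
intros H H' x.
pose proof (nt_nat beta (alpha' x)) as N; simpl in N.
pose proof (H x) as Hx; pose proof (H' x) as Hx'; simpl in *.
now rewrite (fmap_comp G), <- compm_assoc, Hx, compm_assoc, <- N, <- compm_assoc,
  Hx', compm_assoc.
Qed.

(** Reversal moves the brackets of a threefold composite; they are moved back
    here so that both sides are bracketed to the left. *)
Lemma conjugate_vcomp3 (F F' F'' F3 : FunctorData C D) (G : Functor D C)
    (G' G'' G3 : FunctorData D C) (u : IdD ==> G ⊚ F) (u' : IdD ==> G' ⊚ F')
    (u'' : IdD ==> G'' ⊚ F'') (u3 : IdD ==> G3 ⊚ F3)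
    (alpha : F ==> F') (beta : G' ==> G)
    (alpha' : F' ==> F'') (beta' : G'' ==> G')
    (alpha'' : F'' ==> F3) (beta'' : G3 ==> G'') :
  Conjugate u u' alpha beta -> Conjugate u' u'' alpha' beta' ->
  Conjugate u'' u3 alpha'' beta'' ->
  Conjugate u u3 (alpha'' · alpha' · alpha) (beta · beta' · beta'').
Proof.
intros H H' H'' x.
pose proof (conjugate_vcomp (conjugate_vcomp H H') H'' x) as K; simpl in *.
now rewrite <- compm_assoc, K.
Qed.

(** That [v] is the unit of the composite adjunction is a relation rather than a
    definition of [v], so that one and the same unit of H³ ⊣ R³ can be obtained
    from both bracketings, and the given unit of H ⊣ R from composition with the
    identity adjunction. *)
Definition CompositeUnit (F : FunctorData C D) (G : FunctorData D C)
    (K : FunctorData D E) (L : FunctorData E D) (w : IdD ==> L ⊚ K)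
    (u : IdD ==> G ⊚ F) (v : IdD ==> (G ⊚ L) ⊚ (K ⊚ F)) : Prop :=
  forall x, v x = fmap G (w (F x)) ∘ u x.

(** Naturality of the unit of [k] exposes the left-hand side of the hypothesis on
    [alpha] and [beta]; after that, naturality of [beta] at a component of the
    same unit gives the composite unit [v'] on the right. *)
Lemma conjugate_whiskerL (F F' : Functor C D) (G G' : Functor D C)
    (K : Functor D E) (L : Functor E D) (k : Adjunction K L)
    (a : Adjunction F G) (a' : Adjunction F' G')
    (v : IdD ==> (G ⊚ L) ⊚ (K ⊚ F)) (v' : IdD ==> (G' ⊚ L) ⊚ (K ⊚ F'))
    (alpha : F ==> F') (beta : G' ==> G) :
  Conjugate (adj_unit a) (adj_unit a') alpha beta ->
  CompositeUnit (adj_unit k) (adj_unit a) v ->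
  CompositeUnit (adj_unit k) (adj_unit a') v' ->
  Conjugate v v' (K ◁ alpha) (beta ▷ L).
Proof.
intros H Hv Hv' x; rewrite Hv, Hv'.
pose proof (nt_nat (adj_unit k) (alpha x)) as N; simpl in N.
pose proof (nt_nat beta (adj_unit k (F' x))) as N'; simpl in N'.
pose proof (H x) as Hx; simpl in *.
now rewrite compm_assoc, <- (fmap_comp G), <- N, (fmap_comp G), <- compm_assoc,
  Hx, !compm_assoc, N'.
Qed.

Lemma conjugate_whiskerR (F F' : Functor D E) (G G' : Functor E D)
    (K : Functor C D) (L : Functor D C) (k : Adjunction K L)
    (a : Adjunction F G) (a' : Adjunction F' G')
    (v : IdD ==> (L ⊚ G) ⊚ (F ⊚ K)) (v' : IdD ==> (L ⊚ G') ⊚ (F' ⊚ K))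
    (alpha : F ==> F') (beta : G' ==> G) :
  Conjugate (adj_unit a) (adj_unit a') alpha beta ->
  CompositeUnit (adj_unit a) (adj_unit k) v ->
  CompositeUnit (adj_unit a') (adj_unit k) v' ->
  Conjugate v v' (alpha ▷ K) (L ◁ beta).
Proof.
intros H Hv Hv' x; rewrite Hv, Hv'.
pose proof (H (K x)) as Hx; simpl in *.
now rewrite !compm_assoc, <- !(fmap_comp L), Hx.
Qed.

End Calculus.

(** * Transfer of structures along an adjunction *)

Section Transfer.
Context (A : Category) (H R : Functor A A) (adj : Adjunction H R).

Let adj0 : Adjunction (@IdF A) (@IdF A) := adj_id.
Let adj2 : Adjunction (compF H H) (compF R R) := adj_comp adj adj.
Let adj3 : Adjunction (compF H (compF H H)) (compF (compF R R) R) :=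
  adj_comp adj adj2.
Local Notation u0 := (adj_unit adj0).
Local Notation u1 := (adj_unit adj).
Local Notation u2 := (adj_unit adj2).
Local Notation u3 := (adj_unit adj3).

Lemma compositeUnit_10 : CompositeUnit u1 u0 u1.
Proof. intros x; simpl; now rewrite compm_idr. Qed.

Lemma compositeUnit_01 : CompositeUnit u0 u1 u1.
Proof. intros x; simpl; now rewrite (fmap_id R), compm_idl. Qed.

Lemma compositeUnit_11 : CompositeUnit u1 u1 u2.
Proof. intros x; reflexivity. Qed.

Lemma compositeUnit_12 : CompositeUnit u1 u2 u3.
Proof. intros x; reflexivity. Qed.

(** The unit of H³ ⊣ R³ does not depend on the bracketing, so the two whiskerings
    of a transformation can occur in the same equation. *)
Lemma compositeUnit_21 : CompositeUnit u2 u1 u3.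
Proof. intros x; simpl; now rewrite (fmap_comp R), compm_assoc. Qed.

Context (mH : H ⊚ H ==> H) (eH : IdD ==> H) (deltaH : H ==> H ⊚ H)
  (epsilonH : H ==> IdD) (lambdaH : H ⊚ H ==> H ⊚ H) (SH : H ==> H).
Context (mR : R ⊚ R ==> R) (eR : IdD ==> R) (deltaR : R ==> R ⊚ R)
  (epsilonR : R ==> IdD) (lambdaR : R ⊚ R ==> R ⊚ R) (SR : R ==> R).
Context (conj_m : Conjugate u2 u1 mH deltaR) (conj_e : Conjugate u0 u1 eH epsilonR)
  (conj_delta : Conjugate u1 u2 deltaH mR)
  (conj_epsilon : Conjugate u1 u0 epsilonH eR)
  (conj_lambda : Conjugate u2 u2 lambdaH lambdaR)
  (conj_S : Conjugate u1 u1 SH SR).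

Lemma conj_whiskerL_m : Conjugate u3 u2 (H ◁ mH) (deltaR ▷ R).
Proof. exact (conjugate_whiskerL conj_m compositeUnit_12 compositeUnit_11). Qed.
Lemma conj_whiskerR_m : Conjugate u3 u2 (mH ▷ H) (R ◁ deltaR).
Proof. exact (conjugate_whiskerR conj_m compositeUnit_21 compositeUnit_11). Qed.
Lemma conj_whiskerL_e : Conjugate u1 u2 (H ◁ eH) (epsilonR ▷ R).
Proof. exact (conjugate_whiskerL conj_e compositeUnit_10 compositeUnit_11). Qed.
Lemma conj_whiskerR_e : Conjugate u1 u2 (eH ▷ H) (R ◁ epsilonR).
Proof. exact (conjugate_whiskerR conj_e compositeUnit_01 compositeUnit_11). Qed.
Lemma conj_whiskerL_delta : Conjugate u2 u3 (H ◁ deltaH) (mR ▷ R).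
Proof. exact (conjugate_whiskerL conj_delta compositeUnit_11 compositeUnit_12). Qed.
Lemma conj_whiskerR_delta : Conjugate u2 u3 (deltaH ▷ H) (R ◁ mR).
Proof. exact (conjugate_whiskerR conj_delta compositeUnit_11 compositeUnit_21). Qed.
Lemma conj_whiskerL_epsilon : Conjugate u2 u1 (H ◁ epsilonH) (eR ▷ R).
Proof. exact (conjugate_whiskerL conj_epsilon compositeUnit_11 compositeUnit_10). Qed.
Lemma conj_whiskerR_epsilon : Conjugate u2 u1 (epsilonH ▷ H) (R ◁ eR).
Proof. exact (conjugate_whiskerR conj_epsilon compositeUnit_11 compositeUnit_01). Qed.
Lemma conj_whiskerL_lambda : Conjugate u3 u3 (H ◁ lambdaH) (lambdaR ▷ R).
Proof. exact (conjugate_whiskerL conj_lambda compositeUnit_12 compositeUnit_12). Qed.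
Lemma conj_whiskerR_lambda : Conjugate u3 u3 (lambdaH ▷ H) (R ◁ lambdaR).
Proof. exact (conjugate_whiskerR conj_lambda compositeUnit_21 compositeUnit_21). Qed.
Lemma conj_whiskerL_S : Conjugate u2 u2 (H ◁ SH) (SR ▷ R).
Proof. exact (conjugate_whiskerL conj_S compositeUnit_11 compositeUnit_11). Qed.
Lemma conj_whiskerR_S : Conjugate u2 u2 (SH ▷ H) (R ◁ SR).
Proof. exact (conjugate_whiskerR conj_S compositeUnit_11 compositeUnit_11). Qed.

Ltac leaf := first
  [ exact conj_m | exact conj_e | exact conj_delta | exact conj_epsilon
  | exact conj_lambda | exact conj_S | apply conjugate_id
  | exact conj_whiskerL_m | exact conj_whiskerR_m
  | exact conj_whiskerL_e | exact conj_whiskerR_e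
  | exact conj_whiskerL_delta | exact conj_whiskerR_delta
  | exact conj_whiskerL_epsilon | exact conj_whiskerR_epsilon
  | exact conj_whiskerL_lambda | exact conj_whiskerR_lambda
  | exact conj_whiskerL_S | exact conj_whiskerR_S ].

Ltac conjugates :=
  solve [ leaf | eapply conjugate_vcomp; leaf | eapply conjugate_vcomp3; leaf ].

(** Closes an equation on one side of the adjunction by the conjugate equation
    [E].  The transformations on the H side go from the left adjoint of [a] to
    that of [a'].  Associativity and coassociativity correspond only after the
    two sides of the equation are exchanged, whence [symmetry]. *)
Ltac transfer a a' E :=
  let mirror := first
    [ refine (proj1 (conjugate_eq_iff (a := a) (a' := a') _ _) E); conjugates
    | refine (proj2 (conjugate_eq_iff (a := a) (a' := a') _ _) E); conjugates ] in
  first [ mirror | symmetry; mirror ].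

Lemma monad_iff_comonad : IsMonad mH eH <-> IsComonad deltaR epsilonR.
Proof.
split; intros [E1 E2 E3]; constructor.
all: first [transfer adj3 adj E1 | transfer adj adj E2 | transfer adj adj E3].
Qed.

Lemma comonad_iff_monad : IsComonad deltaH epsilonH <-> IsMonad mR eR.
Proof.
split; intros [E1 E2 E3]; constructor.
all: first [transfer adj adj3 E1 | transfer adj adj E2 | transfer adj adj E3].
Qed.

Lemma preBimonad_iff :
  IsPreBimonad mH eH deltaH epsilonH <-> IsPreBimonad mR eR deltaR epsilonR.
Proof.
split; intros [M W E1 E2 E3]; constructor.
1, 7: now apply comonad_iff_monad.
1, 5: now apply monad_iff_comonad.
- transfer adj0 adj0 E1.
- transfer adj0 adj2 E3.
- transfer adj2 adj0 E2.
- transfer adj0 adj0 E1.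
- transfer adj2 adj0 E3.
- transfer adj0 adj2 E2.
Qed.

Lemma entwiningMC_iff_entwiningCM :
  IsEntwiningMC mH eH deltaH epsilonH lambdaH <->
  IsEntwiningCM mR eR deltaR epsilonR lambdaR.
Proof.
split; intros [E1 E2 E3 E4]; constructor.
- transfer adj2 adj E2.
- transfer adj adj2 E1.
- transfer adj3 adj2 E4.
- transfer adj2 adj3 E3.
- transfer adj adj2 E2.
- transfer adj2 adj E1.
- transfer adj2 adj3 E4.
- transfer adj3 adj2 E3.
Qed.

Lemma entwiningCM_iff_entwiningMC :
  IsEntwiningCM mH eH deltaH epsilonH lambdaH <->
  IsEntwiningMC mR eR deltaR epsilonR lambdaR.
Proof.
split; intros [E1 E2 E3 E4]; constructor.
- transfer adj2 adj E2.
- transfer adj adj2 E1.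
- transfer adj3 adj2 E4.
- transfer adj2 adj3 E3.
- transfer adj adj2 E2.
- transfer adj2 adj E1.
- transfer adj2 adj3 E4.
- transfer adj3 adj2 E3.
Qed.

Lemma bimonadMC_iff_bimonadCM :
  IsBimonadMC mH eH deltaH epsilonH lambdaH <->
  IsBimonadCM mR eR deltaR epsilonR lambdaR.
Proof.
split; intros [P W E]; constructor.
all: first [ now apply preBimonad_iff | now apply entwiningMC_iff_entwiningCM
  | transfer adj2 adj2 E ].
Qed.

Lemma bimonadCM_iff_bimonadMC :
  IsBimonadCM mH eH deltaH epsilonH lambdaH <->
  IsBimonadMC mR eR deltaR epsilonR lambdaR.
Proof.
split; intros [P W E]; constructor.
all: first [ now apply preBimonad_iff | now apply entwiningCM_iff_entwiningMC
  | transfer adj2 adj2 E ].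
Qed.

Lemma antipode_transfer :
  IsAntipode mH eH deltaH epsilonH SH -> IsAntipode mR eR deltaR epsilonR SR.
Proof.
intros [E1 E2]; split.
all: first [ transfer adj adj E1 | transfer adj adj E2 ].
Qed.

End Transfer.

Theorem mainTheorem3 (A : Category) (H R : Functor A A) (adj : Adjunction H R)
    (mH : H ⊚ H ==> H) (eH : IdD ==> H)
    (deltaH : H ==> H ⊚ H) (epsilonH : H ==> IdD)
    (monadH : IsMonad mH eH) (comonadH : IsComonad deltaH epsilonH)
    (lambdaH lambdaH' : H ⊚ H ==> H ⊚ H) :
  let adj2 : Adjunction (compF H H) (compF R R) := adj_comp adj adj in
  let mR : R ⊚ R ==> R := mate adj adj2 deltaH in
  let eR : IdD ==> R := mate adj adj_id epsilonH in
  let deltaR : R ==> R ⊚ R := mate adj2 adj mH in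
  let epsilonR : R ==> IdD := mate adj_id adj eH in
  let lambdaR : R ⊚ R ==> R ⊚ R := mate adj2 adj2 lambdaH in
  let lambdaR' : R ⊚ R ==> R ⊚ R := mate adj2 adj2 lambdaH' in
  (IsBimonadMC mH eH deltaH epsilonH lambdaH <->
     IsBimonadCM mR eR deltaR epsilonR lambdaR) /\
  (IsBimonadCM mH eH deltaH epsilonH lambdaH' <->
     IsBimonadMC mR eR deltaR epsilonR lambdaR') /\
  (IsBimonadMC mH eH deltaH epsilonH lambdaH /\
     HasAntipode mH eH deltaH epsilonH ->
   IsBimonadCM mR eR deltaR epsilonR lambdaR /\
     HasAntipode mR eR deltaR epsilonR).
Proof.
intros adj2 mR eR deltaR epsilonR lambdaR lambdaR'.
pose proof (conjugate_mate adj2 adj mH) as conj_m.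
pose proof (conjugate_mate adj_id adj eH) as conj_e.
pose proof (conjugate_mate adj adj2 deltaH) as conj_delta.
pose proof (conjugate_mate adj adj_id epsilonH) as conj_epsilon.
pose proof (conjugate_mate adj2 adj2 lambdaH) as conj_lambda.
pose proof (conjugate_mate adj2 adj2 lambdaH') as conj_lambda'.
assert (part1 : IsBimonadMC mH eH deltaH epsilonH lambdaH <->
    IsBimonadCM mR eR deltaR epsilonR lambdaR)
  by exact (bimonadMC_iff_bimonadCM conj_m conj_e conj_delta conj_epsilon
    conj_lambda).
split; [exact part1 | split].
- exact (bimonadCM_iff_bimonadMC conj_m conj_e conj_delta conj_epsilon
    conj_lambda').
- intros [bimonad [S antipode]]; split; [now apply part1 |].
  exists (mate adj adj S).
  exact (antipode_transfer conj_m conj_e conj_delta conj_epsilon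
    (conjugate_mate adj adj S) antipode).
Qed.
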